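(* Let $k$ be a field, $R=k[x_1,\dots,x_n]$, and let $a\ge b\ge 1$ be integers. Suppose $J,K\subseteq[n]=\{1,\dots,n\}$ are nonempty with $K\subseteq J$. If $I=\mathfrak m_J^a\cap\mathfrak m_K^b$, then for all $i\ge 0$ $$\beta_{i,i+a}(I)=\binom{|K|+a-1}{a+i}\binom{a+i-1}{i}+\sum_{j=1}^{a-b}\ \sum_{k=0}^{|J\setminus K|-1}\binom{k+j-1}{j-1}\binom{|K|+a-j-1}{a-j}\binom{|K|+k}{i}$$ and $\beta_{i,j}(I)=0$ for all other $i,j\ge 0$.
   Context: For a nonempty subset $J=\{j_1,\dots,j_t\}\subseteq[n]$, $\mathfrak m_J=(x_{j_1},\dots,x_{j_t})\subset R$. $R$ is standard graded, and $\beta_{i,j}(I)$ denotes the $(i,j)$-th graded Betti number of the ideal $I$ regarded as an $R$-module, i.e. the number of copies of $R(-j)$ in homological degree $i$ of the minimal graded free resolution $\cdots\to F_1\to F_0\to I\to 0$. Empty sums are $0$, and $\binom{p}{q}=0$ if $0\le p<q$. The summation index $k$ in the formula is an integer, unrelated to the field $k$. *)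

(* Defs.v *)
From mathcomp Require Import all_boot all_order all_algebra.
From mathcomp Require Import mpoly.

Set Implicit Arguments.
Unset Strict Implicit.
Unset Printing Implicit Defensive.

Import GRing.Theory.
Local Open Scope ring_scope.

(* Ideals are represented by their (Prop-valued) membership predicates. *)
Section Ideals.
Variable A : comNzRingType.
Implicit Types (S I J : A -> Prop).

Definition ideal_gen S : A -> Prop := fun f =>
  exists s : seq (A * A),
    (forall cg, cg \in s -> S cg.2) /\ f = \sum_(cg <- s) cg.1 * cg.2.

Definition ideal_mul I J : A -> Prop :=
  ideal_gen (fun h => exists f g, [/\ I f, J g & h = f * g]).

Fixpoint ideal_exp I (m : nat) : A -> Prop :=
  if m is m'.+1 then ideal_mul I (ideal_exp I m') else fun _ => True.

Definition ideal_cap I J : A -> Prop := fun f => I f /\ J f.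

End Ideals.

Definition mJ (k : fieldType) (n : nat) (J : {set 'I_n}) : {mpoly k[n]} -> Prop :=
  ideal_gen (fun f => exists2 j, j \in J & f = 'X_j).

(* Elements of F_i = R^(rank i) are row vectors and maps act by right
   multiplication: [diff i] is the matrix of F_(i+1) -> F_i and [aug] that of
   F_0 -> R.  The p-th basis vector of F_i has degree [shift p], i.e. it
   generates a summand R(- shift p). *)
Record free_complex (k : fieldType) (n : nat) := FreeComplex {
  rank : nat -> nat;
  shift : forall i, 'I_(rank i) -> int;
  diff : forall i, 'M[{mpoly k[n]}]_(rank i.+1, rank i);
  aug : 'cV[{mpoly k[n]}]_(rank 0)
}.

Arguments shift {k n} f i _.
Arguments diff {k n} f i.

Section Resolutions.
Variables (k : fieldType) (n : nat).
Implicit Types (F : free_complex k n) (I : {mpoly k[n]} -> Prop).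

(* Homogeneity of degree d for an integer d; if d < 0 this forces f = 0. *)
Definition homog_deg (d : int) (f : {mpoly k[n]}) : Prop :=
  forall m, m \in msupp f -> (mdeg m)%:Z = d.

(* All maps preserve degrees. *)
Definition graded F : Prop :=
  (forall i p q, homog_deg (shift F i.+1 p - shift F i q) (diff F i p q)) /\
  (forall p, homog_deg (shift F 0 p) (aug F p ord0)).

(* Exactness of ... -> F_1 -> F_0 -> I -> 0. *)
Definition resolves F I : Prop :=
  [/\ forall f, I f <-> exists v : 'rV_(rank F 0), (v *m aug F) ord0 ord0 = f,
      forall v : 'rV_(rank F 0),
        v *m aug F = 0 <-> exists w : 'rV_(rank F 1), v = w *m diff F 0
    & forall i (v : 'rV_(rank F i.+1)),
        v *m diff F i = 0 <->
        exists w : 'rV_(rank F i.+2), v = w *m diff F i.+1].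

(* The image of F_(i+1) lies in (x_1, ..., x_n) F_i. *)
Definition minimal F : Prop :=
  forall i p q, (diff F i p q)@_0%MM = 0.

Definition min_graded_free_res F I : Prop :=
  [/\ graded F, resolves F I & minimal F].

Definition num_copies F (i : nat) (j : int) : nat :=
  #|[set p : 'I_(rank F i) | shift F i p == j]|.

(* beta_(i,j)(I) = b.  As a minimal graded free resolution is only unique up to
   isomorphism, b is required to be the count in every one of them; the first
   conjunct excludes vacuity. *)
Definition graded_betti I (i : nat) (j : int) (b : nat) : Prop :=
  (exists F, min_graded_free_res F I) /\
  (forall F, min_graded_free_res F I -> num_copies F i j = b).

End Resolutions.

(* Main.v *)
(* Let x be a variable of J \ K, or of J = K when K plays no role, and write
   I(J, a) for the ideal, with b and K fixed.  Then I(J, a) = I(J - x, a) +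
   x I(J, a - 1), where I(J - x, a) is contained in I(J, a - 1) and x is regular
   modulo I(J - x, a), so there is an exact sequence
     0 -> I(J - x, a)(-1) -> I(J - x, a) + I(J, a - 1)(-1) -> I(J, a) -> 0.
   If the two smaller ideals have linear resolutions in degrees a and a - 1, the
   mapping cone is a linear resolution in degree a, hence minimal, and the Betti
   numbers satisfy
     beta_i(I(J, a)) = beta_i(I(J - x, a)) + beta_i(I(J, a - 1))
                       + beta_(i-1)(I(J - x, a)).
   The closed formula satisfies the same recursion.  That the count does not
   depend on the resolution is the usual comparison argument: the constant terms
   of two opposite comparison maps are mutually inverse and respect degrees. *)
Require Import Defs.
From Stdlib Require Import IndefiniteDescription.
From mathcomp Require Import all_boot all_order all_algebra.
From mathcomp Require Import mpoly.

Set Implicit Arguments.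
Unset Strict Implicit.
Unset Printing Implicit Defensive.

Import GRing.Theory.
Local Open Scope ring_scope.

(** * Graded pieces of polynomials *)

Section Homogeneity.
Variables (k : fieldType) (n : nat).
Implicit Types (f g : {mpoly k[n]}) (d e : int).

(** The degree [d] is an integer, so that differences of shifts can be inserted unchecked; for
    negative [d] the component is 0. *)
Definition hcomp d f : {mpoly k[n]} :=
  \sum_(m <- msupp f | (mdeg m)%:Z == d) f@_m *: 'X_[m].

Lemma mcoeff_hcomp d f m :
  (hcomp d f)@_m = if (mdeg m)%:Z == d then f@_m else 0.
Proof.
rewrite /hcomp raddf_sum /=.
under eq_bigr => i _ do rewrite mcoeffZ mcoeffX.
case: (boolP (m \in msupp f)) => [mf|mf].
  rewrite big_mkcond (bigD1_seq m) ?msupp_uniq //= eqxx mulr1 big1 ?addr0 //.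
  by move=> i /negPf->; rewrite mulr0 if_same.
rewrite (memN_msupp_eq0 mf) if_same big1_seq // => i /andP[_ fi].
by case: eqP => [E|_]; [rewrite -E fi in mf | rewrite mulr0].
Qed.

Lemma homog_degP d f : homog_deg d f <-> forall m, f@_m != 0 -> (mdeg m)%:Z = d.
Proof.
by split=> H m; [rewrite -mcoeff_msupp|rewrite mcoeff_msupp]; apply: H.
Qed.

Lemma hcomp_homog d f : homog_deg d (hcomp d f).
Proof.
apply/homog_degP => m; rewrite mcoeff_hcomp.
by case: ifP => [/eqP //|_]; rewrite eqxx.
Qed.

Lemma hcomp_id d f : homog_deg d f -> hcomp d f = f.
Proof.
move/homog_degP=> H; apply/mpolyP => m; rewrite mcoeff_hcomp.
case: eqP => // ne; apply/esym/eqP/negPn/negP => /H; exact: ne.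
Qed.

Lemma hcomp_sum d (I : finType) (F : I -> {mpoly k[n]}) :
  hcomp d (\sum_i F i) = \sum_i hcomp d (F i).
Proof.
apply/mpolyP => m; rewrite mcoeff_hcomp !(raddf_sum (mcoeff m)) /=.
case: ifP => Ed; last rewrite big1 // => i _.
  by apply: eq_bigr => i _; rewrite mcoeff_hcomp Ed.
by rewrite mcoeff_hcomp Ed.
Qed.

(** In each coefficient of the product only exponents of [g] of degree [e] contribute, so the
    partner exponent in [f] has degree [d - e]. *)
Lemma hcompM d e f g : homog_deg e g -> hcomp d (f * g) = hcomp (d - e) f * g.
Proof.
move/homog_degP=> H; apply/mpolyP => m; rewrite mcoeff_hcomp !mcoeffM.
transitivity (\sum_(x : 'X_{1..n < (mdeg m).+1, (mdeg m).+1} |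
    m == (x.1 + x.2)%MM) (if (mdeg m)%:Z == d then f@_x.1 * g@_x.2 else 0)).
  by case: ifP => // _; rewrite big1.
apply: eq_bigr => x /eqP Em; rewrite mcoeff_hcomp.
have [->|nz] := eqVneq g@_x.2 0; first by rewrite !mulr0 if_same.
have -> : ((mdeg m)%:Z == d) = ((mdeg x.1)%:Z == d - e).
  have := congr1 (fun t => (mdeg t)%:Z == d) Em => /= ->.
  by rewrite mdegD PoszD (H _ nz) eq_sym -subr_eq eq_sym.
by case: ifP; rewrite ?mul0r.
Qed.

Lemma homog_deg0 d : homog_deg d (0 : {mpoly k[n]}).
Proof. by move=> m; rewrite msupp0. Qed.

Lemma homog_degN d f : homog_deg d f -> homog_deg d (- f).
Proof.
by move/homog_degP=> H; apply/homog_degP=> m; rewrite mcoeffN oppr_eq0; apply: H.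
Qed.

Lemma homog_degM d e f g :
  homog_deg d f -> homog_deg e g -> homog_deg (d + e) (f * g).
Proof.
move=> hf hg; suff <- : hcomp (d + e) (f * g) = f * g by apply: hcomp_homog.
by rewrite (hcompM _ _ hg) addrK hcomp_id.
Qed.

Lemma homog_degXi i : homog_deg 1 ('X_i : {mpoly k[n]}).
Proof. by move=> m; rewrite msuppX inE => /eqP->; rewrite mdeg1. Qed.

Lemma homog_deg_mcoeff0 d f : d != 0 -> homog_deg d f -> f@_0%MM = 0.
Proof.
move=> nd /homog_degP H; apply/eqP; apply/negPn/negP => /H.
by rewrite mdeg0 => E; rewrite -E eqxx in nd.
Qed.

End Homogeneity.

(** Serves to choose the components of a chain map one after another; their matrix types vary with
    the index, and [P] is the invariant that keeps the construction going. *)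
Lemma dependent_choice (T : nat -> Type) (P : forall i, T i -> Prop)
    (S : forall i, T i -> T i.+1 -> Prop) (x0 : T 0%N) :
  P 0%N x0 ->
  (forall i x, P i x -> exists2 y, P i.+1 y & S i x y) ->
  exists f : forall i, T i,
    [/\ f 0%N = x0, forall i, P i (f i) & forall i, S i (f i) (f i.+1)].
Proof.
move=> P0 exS.
have step i (x : {x | P i x}) : {y | P i.+1 y /\ S i (sval x) y}.
  apply: constructive_indefinite_description.
  by have [y Py Sy] := exS i _ (svalP x); exists y.
pose g := nat_rect (fun i => {x | P i x}) (exist _ x0 P0)
  (fun i x => exist _ _ (proj1 (svalP (step i x)))).
exists (fun i => sval (g i)); split=> // i; first exact: svalP.
exact: (proj2 (svalP (step i (g i)))).
Qed.

(** * Degree-preserving matrices *)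

Section HomogeneousMatrices.
Variables (k : fieldType) (n : nat).

Definition homog_mx r s (al : 'I_r -> int) (be : 'I_s -> int)
    (M : 'M[{mpoly k[n]}]_(r, s)) : Prop :=
  forall p q, homog_deg (al p - be q) (M p q).

(** Replace each entry of [W] by its component of the expected degree: what is dropped contributes
    to [W *m D] only in degrees where [N] vanishes. *)
Lemma homog_mx_factor r s t (al : 'I_r -> int) (be : 'I_s -> int)
    (ga : 'I_t -> int) (N : 'M[{mpoly k[n]}]_(r, t)) (D : 'M_(s, t)) W :
  homog_mx al ga N -> homog_mx be ga D -> N = W *m D ->
  exists2 W', homog_mx al be W' & N = W' *m D.
Proof.
move=> hN hD NW; exists (\matrix_(p, q) hcomp (al p - be q) (W p q)).
  by move=> p q; rewrite mxE; apply: hcomp_homog.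
apply/matrixP => p q; rewrite -(hcomp_id (hN p q)) NW !mxE hcomp_sum.
apply: eq_bigr => u _; rewrite mxE (hcompM _ _ (hD u q)).
by rewrite opprB addrA subrK.
Qed.

Lemma homog_mxM r s t (al : 'I_r -> int) (be : 'I_s -> int) (ga : 'I_t -> int)
    (M : 'M[{mpoly k[n]}]_(r, s)) (N : 'M_(s, t)) :
  homog_mx al be M -> homog_mx be ga N -> homog_mx al ga (M *m N).
Proof.
move=> hM hN p q; rewrite mxE.
suff <- : hcomp (al p - ga q) (\sum_j M p j * N j q) = \sum_j M p j * N j q.
  exact: hcomp_homog.
rewrite hcomp_sum; apply: eq_bigr => u _; rewrite (hcompM _ _ (hN u q)).
by rewrite opprB addrA subrK hcomp_id.
Qed.

Lemma factor_rows r s t (N : 'M[{mpoly k[n]}]_(r, t)) (D : 'M_(s, t)) :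
  (forall p, exists w, row p N = w *m D) -> exists W, N = W *m D.
Proof.
move=> /fin_all_exists[f fE]; exists (\matrix_p f p).
by apply/row_matrixP => p; rewrite row_mul rowK.
Qed.

End HomogeneousMatrices.

(** * Uniqueness of graded Betti numbers *)

Section Comparison.
Variables (k : fieldType) (n : nat).
Implicit Types (F G : free_complex k n) (I : {mpoly k[n]} -> Prop).

Lemma resolves_aug_in F I p : resolves F I -> I (aug F p ord0).
Proof.
case=> HI _ _; apply/HI; exists (delta_mx 0 p).
by rewrite -rowE mxE.
Qed.

Lemma aug_factor G I r (N : 'M_(r, 1)) : resolves G I ->
  (forall p, I (N p ord0)) -> exists W, N = W *m aug G.
Proof.
move=> [HI _ _] NI; apply: factor_rows => p.
have /HI[w wE] := NI p; exists w; apply/matrixP => i j.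
by rewrite !ord1 wE mxE.
Qed.

Lemma diff0_factor G I r (N : 'M_(r, rank G 0)) : resolves G I ->
  N *m aug G = 0 -> exists W, N = W *m diff G 0.
Proof.
move=> [_ H _] N0; apply: factor_rows => p; apply/H.
by rewrite -row_mul N0 linear0.
Qed.

Lemma diff_factor G I i r (N : 'M_(r, rank G i.+1)) : resolves G I ->
  N *m diff G i = 0 -> exists W, N = W *m diff G i.+1.
Proof.
move=> [_ _ H] N0; apply: factor_rows => p; apply/H.
by rewrite -row_mul N0 linear0.
Qed.

Lemma diff_aug F I : resolves F I -> diff F 0 *m aug F = 0.
Proof.
move=> [_ H _]; apply/row_matrixP => p; rewrite row_mul linear0.
by apply/H; exists (delta_mx 0 p); rewrite rowE.
Qed.

Lemma diff_diff F I i : resolves F I -> diff F i.+1 *m diff F i = 0.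
Proof.
move=> [_ _ H]; apply/row_matrixP => p; rewrite row_mul linear0.
by apply/H; exists (delta_mx 0 p); rewrite rowE.
Qed.

(** Lifting of an inclusion of ideals to resolutions. Equality of the ideals gives uniqueness of
    Betti numbers, a proper inclusion gives the map used in the mapping cone. *)
Lemma comparison F G I I' : graded F -> resolves F I -> graded G ->
    resolves G I' -> (forall f, I f -> I' f) ->
  exists phi : forall i, 'M_(rank F i, rank G i),
  [/\ forall i, homog_mx (shift F i) (shift G i) (phi i),
      phi 0%N *m aug G = aug F
    & forall i, phi i.+1 *m diff G i = diff F i *m phi i].
Proof.
move=> [gF gF0] rF [gG gG0] rG sub.
(* The invariant says that the next square can be filled, by a matrix [W] whose degrees are
   corrected afterwards. *)
pose P i (phi : 'M_(rank F i, rank G i)) :=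
  homog_mx (shift F i) (shift G i) phi /\
  exists W, diff F i *m phi = W *m diff G i.
have [phi0 hphi0 phi0E] : exists2 phi0, homog_mx (shift F 0) (shift G 0) phi0
    & phi0 *m aug G = aug F.
  have [|W WE] := @aug_factor G I' _ (aug F) rG.
    by move=> p; apply: sub; apply: resolves_aug_in.
  have [||W' h E] :=
      @homog_mx_factor _ _ _ _ _ (shift F 0) (shift G 0) (fun=> 0) _ _ _ _ _ WE.
  - by move=> p q; rewrite ord1 subr0.
  - by move=> p q; rewrite ord1 subr0.
  by exists W'.
have [||phi [phi_0 hphi phiE]] := @dependent_choice _ P
  (fun i phi phi' => phi' *m diff G i = diff F i *m phi) phi0.
- split=> //; apply: (diff0_factor rG).
  by rewrite -mulmxA phi0E (diff_aug rF).
- move=> i x [hx [W WE]].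
  have [||W' h E] := @homog_mx_factor _ _ _ _ _ (shift F i.+1) (shift G i.+1)
      (shift G i) _ _ _ _ _ WE.
  + exact: homog_mxM hx.
  + exact: gG.
  exists W' => //; split=> //; apply: (diff_factor rG).
  by rewrite -mulmxA -E mulmxA (diff_diff _ rF) mul0mx.
exists phi; split=> //; last by rewrite phi_0.
by move=> i; case: (hphi i).
Qed.

Local Notation const_coef := (map_mx (mcoeff (0%MM : 'X_{1..n}))).

Lemma minimal_const_coef F i : minimal F -> const_coef (diff F i) = 0.
Proof. by move=> mF; apply/matrixP => p q; rewrite !mxE mF. Qed.

(* The homotopy from [phi psi] to the identity is [h] in degree [i]; its
   other half is the term [Z], which vanishes modulo the variables. *)
Lemma homotopy_mod_vars F I (E : forall i, 'M_(rank F i)) : resolves F I ->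
    minimal F -> E 0%N *m aug F = 0 ->
    (forall i, E i.+1 *m diff F i = diff F i *m E i) ->
  forall i, const_coef (E i) = 0.
Proof.
move=> rF mF E0 ES i.
suff [h [Z [-> _ Z0]]] : exists h Z, [/\ E i = h *m diff F i + Z,
    diff F i *m Z = 0 & const_coef Z = 0].
  by rewrite map_mxD map_mxM /= minimal_const_coef // mulmx0 Z0 addr0.
elim: i => [|i [h [Z [Ei DZ _]]]].
  have [h hE] := diff0_factor rF E0; exists h, 0.
  by rewrite addr0 mulmx0 map_mx0.
(* This difference is killed by [diff F i] because [diff F i *m Z = 0]; exactness yields the next
   half of the homotopy. *)
have [|h' h'E] := @diff_factor F I i _ (E i.+1 - diff F i *m h) rF.
  by rewrite mulmxBl ES Ei mulmxDr DZ addr0 mulmxA subrr.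
exists h', (diff F i *m h); split.
- by rewrite -h'E subrK.
- by rewrite mulmxA (diff_diff _ rF) mul0mx.
by rewrite map_mxM /= minimal_const_coef // mul0mx.
Qed.

(** The constant terms of the two comparison maps compose to the identity and join only basis
    vectors of equal degree. Their blocks in degree [j] thus satisfy [M *m N = 1%:M], which bounds
    the number of rows of [M] by its number of columns. *)
Lemma num_copies_le F G I i j : graded F -> resolves F I -> minimal F ->
  graded G -> resolves G I -> (num_copies F i j <= num_copies G i j)%N.
Proof.
move=> gF rF mF gG rG.
have [phi [hphi phi0 phiS]] := comparison gF rF gG rG (fun _ => id).
have [psi [_ psi0 psiS]] := comparison gG rG gF rF (fun _ => id).
have E : const_coef (phi i) *m const_coef (psi i) = 1%:M.
  apply/eqP; rewrite -subr_eq0.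
  have <- : const_coef (phi i *m psi i - 1%:M)
      = const_coef (phi i) *m const_coef (psi i) - 1%:M.
    by rewrite map_mxB map_mxM map_mx1.
  apply/eqP; apply: (homotopy_mod_vars (E := fun i => phi i *m psi i - 1%:M) rF mF).
    by rewrite mulmxBl -mulmxA psi0 phi0 mul1mx subrr.
  move=> l; rewrite mulmxBl mulmxBr -mulmxA psiS mulmxA phiS.
  by rewrite mul1mx mulmx1 mulmxA.
rewrite /num_copies; set A := [set p | _]; set B := [set q | _].
pose M := \matrix_(p < #|A|, q < #|B|) const_coef (phi i) (enum_val p) (enum_val q).
pose N := \matrix_(q < #|B|, p < #|A|) const_coef (psi i) (enum_val q) (enum_val p).
suff : M *m N = 1%:M by apply: mulmx1_min.
apply/matrixP => p p'; rewrite mxE.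
under eq_bigr => q _ do rewrite [M _ _]mxE [N _ _]mxE.
rewrite -(big_enum_val (fun q => const_coef (phi i) (enum_val p) q
                     * const_coef (psi i) q (enum_val p'))) /=.
transitivity ((const_coef (phi i) *m const_coef (psi i)) (enum_val p) (enum_val p')).
  (* For [q] outside [B] the entry of [phi i] is homogeneous of nonzero degree, so its constant term
     is 0. *)
  rewrite [RHS]mxE big_mkcond; apply: eq_bigr => q _; case: ifPn => // qB.
  rewrite mxE (homog_deg_mcoeff0 _ (hphi i _ _)) ?mul0r //.
  have := enum_valP p; rewrite inE => /eqP->.
  by apply: contra qB; rewrite inE subr_eq0 eq_sym.
by rewrite E !mxE (inj_eq enum_val_inj).
Qed.

Lemma num_copies_eq F G I i j : min_graded_free_res F I ->
  min_graded_free_res G I -> num_copies F i j = num_copies G i j.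
Proof.
move=> [gF rF mF] [gG rG mG]; apply/eqP; rewrite eqn_leq.
by rewrite (num_copies_le i j gF rF mF gG rG) (num_copies_le i j gG rG mG gF rF).
Qed.

End Comparison.

Lemma shiftS_sub i d : Posz (i.+1 + d) - Posz (i + d) = 1.
Proof. by rewrite addSn -add1n PoszD addrK. Qed.

Lemma regular_scale (R : idomainType) r s (x : R) (M : 'M_(r, s)) :
  x != 0 -> x *: M = 0 -> M = 0.
Proof.
move=> x0 E; apply/matrixP => p q; move/matrixP/(_ p q): E; rewrite !mxE.
by move/eqP; rewrite mulf_eq0 (negPf x0) => /eqP.
Qed.

(** * Linear resolutions and splittings *)

Section LinearResolutions.
Variables (k : fieldType) (n : nat).
Implicit Types (F G : free_complex k n) (I A B : {mpoly k[n]} -> Prop).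
Implicit Types (d : nat) (beta : nat -> nat).

(** Such a resolution is minimal automatically: neighbouring shifts differ by 1, so the
    differentials consist of linear forms. The ranks [beta] are then the Betti numbers. *)
Definition linear_res I d beta : Prop := exists F,
  [/\ graded F, resolves F I, forall i p, shift F i p = Posz (i + d)
    & forall i, rank F i = beta i].

Lemma linear_res_eq I I' d beta beta' : (forall f, I f <-> I' f) ->
  beta =1 beta' -> linear_res I d beta -> linear_res I' d beta'.
Proof.
move=> HI Hb [F [gF [r0 r1 r2] sF rF]]; exists F; split=> //.
  by split=> // f; rewrite -HI; apply: r0.
by move=> i; rewrite rF Hb.
Qed.

Lemma linear_res_graded_betti I d beta i (j : nat) : linear_res I d beta ->
  graded_betti I i (Posz j) (if j == (i + d)%N then beta i else 0%N).
Proof.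
move=> [F [gF rF sF bF]].
have mF : min_graded_free_res F I.
  split=> // l p q; apply: homog_deg_mcoeff0 (proj1 gF l p q).
  by rewrite !sF shiftS_sub.
have nF : num_copies F i (Posz j) = if j == (i + d)%N then beta i else 0%N.
  rewrite /num_copies; under eq_finset => p do rewrite sF eqz_nat eq_sym.
  case: eqP => _; last by apply: eq_card0 => p; rewrite inE.
  by rewrite -bF -[RHS]card_ord; apply: eq_card => p; rewrite inE.
by split=> [|G mG]; [exists F | rewrite -nF; apply: num_copies_eq mG mF].
Qed.

Lemma linear_res0 I d : (forall f, I f <-> f = 0) -> linear_res I d (fun=> 0%N).
Proof.
move=> HI; exists (@FreeComplex k n (fun=> 0%N) (fun i _ => Posz (i + d))
  (fun=> 0) 0); split=> //=.
  by split=> [i []|[]].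
split=> /=.
- move=> f; rewrite HI; split=> [->|[v <-]]; first by exists 0; rewrite mul0mx mxE.
  by rewrite mulmx0 mxE.
- by move=> v; split=> _; [exists 0; rewrite mulmx0 thinmx0 | rewrite mulmx0].
- by move=> i v; split=> _; [exists 0; rewrite mulmx0 thinmx0 | rewrite thinmx0].
Qed.

Lemma linear_res1 I : (forall f, I f) -> linear_res I 0 (fun i => i == 0%N).
Proof.
move=> HI; exists (@FreeComplex k n (fun i => i == 0%N) (fun i _ => Posz (i + 0))
  (fun=> 0) 1%:M); split=> //=.
  split=> /= [i []//|p]; rewrite ord1 mxE eqxx => m.
  by rewrite msupp1 inE => /eqP->; rewrite mdeg0.
split=> /=.
- by move=> f; split=> // _; exists f%:M; rewrite mulmx1 mxE eqxx.
- move=> v; rewrite mulmx1; split=> [->|[w ->]]; last by rewrite mulmx0.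
  by exists 0; rewrite mulmx0.
- move=> i v; split=> _; last by rewrite mulmx0.
  by exists 0; rewrite mulmx0; apply: thinmx0.
Qed.

Section Splitting.
Variables (x : {mpoly k[n]}) (d : nat) (F G : free_complex k n).
Variable (phi : forall i, 'M[{mpoly k[n]}]_(rank F i, rank G i)).

Definition lag F i : nat := if i is i'.+1 then rank F i' else 0.

(** The sign is that of the mapping cone; it cancels the cross terms in the square of the
    differential. *)
Definition lag_diff F i : 'M[{mpoly k[n]}]_(rank F i, lag F i) :=
  if i is i'.+1 then - diff F i' else 0.

(* The mapping cone of [(x, - phi) : F(-1) -> F + G(-1)]. *)
Definition split_cone : free_complex k n := {|
  rank := fun i => (rank F i + (rank G i + lag F i))%N;
  shift := fun i _ => Posz (i + d);
  diff := fun i => col_mx (row_mx (diff F i) 0)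
    (col_mx (row_mx 0 (row_mx (diff G i) 0))
            (row_mx x%:M (row_mx (- phi i) (lag_diff F i))));
  aug := col_mx (aug F) (col_mx (x *: aug G) 0) |}.

Lemma row3P r s t (v : 'rV[{mpoly k[n]}]_(r + (s + t))) :
  exists p q u, v = row_mx p (row_mx q u).
Proof.
exists (lsubmx v), (lsubmx (rsubmx v)), (rsubmx (rsubmx v)).
by rewrite !hsubmxK.
Qed.

Lemma row3_eq0 r s t (p : 'rV[{mpoly k[n]}]_r) (q : 'rV_s) (u : 'rV_t) :
  row_mx p (row_mx q u) = 0 -> [/\ p = 0, q = 0 & u = 0].
Proof.
move=> E; have Er := congr1 rsubmx E; rewrite row_mxKr linear0 in Er.
split; first by have := congr1 lsubmx E; rewrite row_mxKl linear0.
  by have := congr1 lsubmx Er; rewrite row_mxKl linear0.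
by have := congr1 rsubmx Er; rewrite row_mxKr linear0.
Qed.

Lemma split_cone_aug (p : 'rV_(rank F 0)) (q : 'rV_(rank G 0)) (u : 'rV_0) :
  row_mx p (row_mx q u) *m aug split_cone = p *m aug F + x *: (q *m aug G).
Proof. by rewrite !mul_row_col mulmx0 addr0 scalemxAr. Qed.

Lemma split_cone_diff i (p : 'rV_(rank F i.+1)) (q : 'rV_(rank G i.+1))
    (u : 'rV_(rank F i)) :
  row_mx p (row_mx q u) *m diff split_cone i =
  row_mx (p *m diff F i + x *: u)
    (row_mx (q *m diff G i - u *m phi i) (u *m lag_diff F i)).
Proof.
rewrite !mul_row_col !mul_mx_row !mulmx0 !add_row_mx mul_mx_scalar.
by rewrite mulmxN !add0r.
Qed.

Hypotheses (gF : graded F) (sF : forall i p, shift F i p = Posz (i + d)).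
Hypotheses (gG : graded G) (sG : forall i p, (shift G i p + 1 = Posz (i + d))).
Hypothesis hphi : forall i, homog_mx (shift F i) (shift G i) (phi i).
Hypothesis hx : homog_deg 1 x.

Let homog1 r s (M : 'M[{mpoly k[n]}]_(r, s)) := forall p q, homog_deg 1 (M p q).

Let homog1_0 r s : homog1 (0 : 'M_(r, s)).
Proof. by move=> p q; rewrite mxE; apply: homog_deg0. Qed.

Let homog1_row r s t (M : 'M_(r, s)) (N : 'M_(r, t)) :
  homog1 M -> homog1 N -> homog1 (row_mx M N).
Proof. by move=> hM hN p q; rewrite mxE; case: splitP. Qed.

Let homog1_col r s t (M : 'M_(r, t)) (N : 'M_(s, t)) :
  homog1 M -> homog1 N -> homog1 (col_mx M N).
Proof. by move=> hM hN p q; rewrite mxE; case: splitP. Qed.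

Lemma split_cone_graded : graded split_cone.
Proof.
have dF i : homog1 (diff F i).
  by move=> p q; have := proj1 gF i p q; rewrite !sF shiftS_sub.
have dG i : homog1 (diff G i).
  move=> p q; have := proj1 gG i p q.
  by rewrite -[shift G i.+1 p](addrK 1) sG -[shift G i q](addrK 1) sG opprB
    addrA subrK shiftS_sub.
split=> [i p q|p].
  rewrite [shift _ _ _]/= [shift _ i _]/= shiftS_sub; move: p q.
  apply: homog1_col; last apply: homog1_col; do ?apply: homog1_row => //.
  - move=> p q; rewrite mxE; case: eqP => _ //; exact: homog_deg0.
  - move=> p q; rewrite mxE; apply: homog_degN; have := @hphi _ p q.
    by rewrite sF -(@sG i q) addrAC subrr add0r.
  - case: i => [|i] //= p q; rewrite mxE; exact/homog_degN/dF.
rewrite /= mxE; case: splitP => [p1 _|p2 _].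
  by have := proj2 gF p1; rewrite sF.
rewrite mxE; case: splitP => [p1 _|p3 _]; last by rewrite mxE; apply: homog_deg0.
rewrite mxE -[Posz d](@sG 0%N p1) addrC; apply: homog_degM => //.
exact: (proj2 gG).
Qed.

Variables (A B I : {mpoly k[n]} -> Prop).
Hypotheses (rF : resolves F A) (rG : resolves G B).
Hypotheses (phi_aug : phi 0%N *m aug G = aug F)
  (phi_diff : forall i, phi i.+1 *m diff G i = diff F i *m phi i).
Hypothesis x_neq0 : x != 0.
Hypothesis colon : forall f : {mpoly k[n]}, A (x * f) -> A f.
Hypothesis sumI : forall f, I f <-> exists g h, [/\ A g, B h & f = g + x * h].

Let aug_in (H : free_complex k n) (J : {mpoly k[n]} -> Prop) (v : 'rV_(rank H 0)) :
  resolves H J -> J ((v *m aug H) ord0 ord0).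
Proof. by case=> HJ _ _; apply/HJ; exists v. Qed.

Let mx11_scalar_eq (M N : 'M[{mpoly k[n]}]_1) :
  M ord0 ord0 = N ord0 ord0 -> M = N.
Proof. by move=> E; apply/matrixP => i j; rewrite !ord1. Qed.

Lemma split_cone_resolves : resolves split_cone I.
Proof.
have [HF F0 FS] := rF; have [HG G0 GS] := rG.
split.
- move=> f; rewrite sumI; split=> [[g [h [/HF[p <-] /HG[q <-] ->]]]|[v <-]].
    by exists (row_mx p (row_mx q 0)); rewrite split_cone_aug !mxE.
  have [p [q [u ->]]] := row3P v; rewrite split_cone_aug.
  exists ((p *m aug F) ord0 ord0), ((q *m aug G) ord0 ord0).
  split; [exact: (aug_in _ rF)|exact: (aug_in _ rG)|].
  by rewrite mxE; congr (_ + _); rewrite mxE.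
- move=> v; split=> [|[w ->]]; last first.
    have [p [q [u ->]]] := row3P w; rewrite split_cone_diff split_cone_aug.
    rewrite mulmxDl mulmxBl -!mulmxA phi_aug (diff_aug rF) (diff_aug rG).
    by rewrite !mulmx0 -scalemxAl add0r sub0r scalerN subrr.
  have [p [q [u ->]]] := row3P v; rewrite split_cone_aug => E.
  (* The relation puts [x] times this element into [A], and [colon] removes [x]. A preimage [r] in
     [F] corrects both [p] and [q] to cycles. *)
  have Aq : A ((q *m aug G) ord0 ord0).
    apply: colon; apply/HF; exists (- p).
    move/eqP: E; rewrite addr_eq0 mulNmx => /eqP->.
    by rewrite opprK mxE.
  have /HF[r /mx11_scalar_eq rE] := Aq.
  have /F0[p' p'E] : (p + x *: r) *m aug F = 0.
    by rewrite mulmxDl -scalemxAl rE.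
  have /G0[q' q'E] : (q - r *m phi 0%N) *m aug G = 0.
    by rewrite mulmxBl -mulmxA phi_aug rE subrr.
  exists (row_mx p' (row_mx q' (- r))).
  rewrite split_cone_diff -p'E -q'E scalerN addrK mulNmx opprK subrK.
  by congr (row_mx _ (row_mx _ _)); rewrite !thinmx0.
- move=> i v; split=> [|[w ->]]; last first.
    have [p [q [u ->]]] := row3P w; rewrite !split_cone_diff /=.
    rewrite mulmxDl mulmxBl !mulmxN -!mulmxA phi_diff !(diff_diff _ rF).
    rewrite (diff_diff _ rG) !mulmx0 scalerN -scalemxAl add0r subrr sub0r.
    rewrite mulNmx -mulmxA opprK addNr.
    suff E0 : u *m diff F i *m lag_diff F i = 0 by rewrite mulNmx E0 oppr0 !row_mx0.
    case: (i) u => [|i'] u; first by rewrite thinmx0.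
    by rewrite mulmxN -mulmxA (diff_diff _ rF) mulmx0 oppr0.
  have [p [q [u ->]]] := row3P v; rewrite split_cone_diff.
  move=> /row3_eq0[pE qE uE].
  have [r rE] : exists r, u = - (r *m diff F i).
    suff [r rE] : exists r, u = r *m diff F i.
      by exists (- r); rewrite mulNmx opprK.
    move: p q u v pE qE uE => p q u _.
    case: i p q u => [|i] p q u pE _ uE; last first.
      by apply/FS; apply: oppr_inj; rewrite -mulmxN uE oppr0.
    (* In the lowest degree the third component is empty. Applying [aug F] to the first one gives
       [x *: (u *m aug F) = 0] instead, and [x] is regular. *)
    apply/F0; apply: (@regular_scale _ _ _ x) => //.
    move/(congr1 (mulmx^~ (aug F))): pE.
    by rewrite mulmxDl mul0mx -mulmxA (diff_aug rF) mulmx0 add0r -scalemxAl.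
  have /FS[p' p'E] : (p - x *: r) *m diff F i = 0.
    by rewrite mulmxBl -scalemxAl -pE rE scalerN.
  have /GS[q' q'E] : (q + r *m phi i.+1) *m diff G i = 0.
    by rewrite mulmxDl -mulmxA phi_diff -qE rE mulNmx opprK -mulmxA.
  exists (row_mx p' (row_mx q' r)).
  by rewrite split_cone_diff -p'E -q'E subrK addrK mulmxN rE.
Qed.
End Splitting.

(** The cone is linear: the twist by -1 moves the generators for [B] from degree [d] to [d.+1], and
    for the second copy of [A] it is balanced by the homological shift. *)
Lemma linear_res_split (x : {mpoly k[n]}) d (A B I : {mpoly k[n]} -> Prop) alpha beta :
    homog_deg 1 x -> x != 0 ->
    linear_res A d.+1 alpha -> linear_res B d beta ->
    (forall f, A f -> B f) -> (forall f : {mpoly k[n]}, A (x * f) -> A f) ->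
    (forall f, I f <-> exists g h, [/\ A g, B h & f = g + x * h]) ->
  linear_res I d.+1
    (fun i => alpha i + (beta i + if i is i'.+1 then alpha i' else 0))%N.
Proof.
move=> hx x0 [F [gF rF sF bF]] [G [gG rG sG bG]] AB colon sumI.
have [phi [hphi phi_aug phi_diff]] := comparison gF rF gG rG AB.
exists (split_cone x d.+1 phi); split=> //.
- apply: split_cone_graded => // i p; rewrite sG.
  by rewrite addnS -addn1 PoszD.
- exact: split_cone_resolves colon sumI.
- by case=> [|i] /=; rewrite !(bF, bG).
Qed.
End LinearResolutions.

(** * Recursions for the closed formula *)

Section BettiNumbers.
Local Open Scope nat_scope.

(** Betti numbers of the [a]-th power of the ideal of [s] variables. For [a = 0] truncated
    subtraction gives 1 at [i = 0] and 0 elsewhere, as for the unit ideal. *)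
Definition pow_betti s a i := 'C(s + a - 1, a + i) * 'C(a + i - 1, i).

Lemma pow_bettiSS s a i : pow_betti s.+1 a.+1 i =
  pow_betti s a.+1 i
  + (pow_betti s.+1 a i + if i is i'.+1 then pow_betti s a.+1 i' else 0).
Proof.
rewrite /pow_betti !addSn !addnS !subn1 /= binS mulnDl; congr (_ + _).
case: i => [|i]; first by rewrite !addn0 !bin0.
by rewrite !addSn !addnS !subn1 /= -mulnDr -binS.
Qed.

(** Base case of [cap_betti_pair]: it collects the terms that the first new variable adds to a
    power. *)
Lemma pow_betti_pair s a i :
  pow_betti s a i + (if i is i'.+1 then pow_betti s a.+1 i' else 0)
  = 'C(s + a - 1, a) * 'C(s, i).
Proof.
case: i => [|i]; first by rewrite /pow_betti !addn0 !bin0 !muln1.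
rewrite /pow_betti !addnS !addSn !subn1 /=.
case: s => [|s].
  rewrite !add0n (bin0n i.+1) muln0.
  rewrite [X in _ + X * _]bin_small ?ltnS ?leq_addr // bin_small //.
  by rewrite ltnS (leq_trans (leq_pred _)) ?leq_addr.
rewrite addSn /= !binS.
(* Both sides count disjoint pairs of an [a]-subset and a [j]-subset of [s + a] elements. *)
have trinomial j : 'C(s + a, a + j) * 'C(a + j, j) = 'C(s + a, a) * 'C(s, j).
  have [js|sj] := leqP j s; last first.
    by rewrite (bin_small sj) muln0 bin_small // [s + a]addnC ltn_add2l.
  apply/eqP; rewrite -(@eqn_pmul2r (a`! * j`! * (s - j)`!)); last first.
    by rewrite !muln_gt0 !fact_gt0.
  apply/eqP; transitivity (s + a)`!.
    have <- := @bin_fact (s + a) (a + j); last by rewrite addnC leq_add2r.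
    rewrite -(@bin_fact (a + j) j) ?leq_addl // addnK [s + a]addnC subnDl.
    by rewrite -!mulnA; do 2 congr (_ * _); rewrite mulnCA mulnA.
  have <- := @bin_fact (s + a) a; last exact: leq_addl.
  rewrite addnK -(bin_fact js) -!mulnA; congr (_ * _).
  by rewrite mulnCA.
rewrite mulnDl addnA -mulnDr.
have := trinomial i.+1; have := trinomial i; rewrite !addnS binS => E E'.
by rewrite [RHS]mulnDr -E' -E.
Qed.

Variables (s b : nat).

(* With a = b + d, the number of minimal generators of the ideal whose last
   variable, in an order starting with K, is the (l+1)-st one of J \ K. *)
Definition new_gens l d :=
  \sum_(0 <= j < d) 'C(l + j, j) * 'C(s + (b + (d - j.+1)) - 1, b + (d - j.+1)).

(** Here [s], [r], [d] stand for |K|, |J \ K|, a - b. As in the Eliahou-Kervaire formula, a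
    generator whose last variable has [s + l] predecessors contributes ['C(s + l, i)]. *)
Definition cap_betti r d i :=
  pow_betti s (b + d) i + \sum_(0 <= l < r) new_gens l d * 'C(s + l, i).

Lemma new_gensSS l d : new_gens l.+1 d.+1 = new_gens l d.+1 + new_gens l.+1 d.
Proof.
rewrite /new_gens !big_nat_recl //= !bin0 -addnA; congr (_ + _).
rewrite -big_split; apply: eq_bigr => j _ /=.
by rewrite !subSS -mulnDl !addSn !addnS binS.
Qed.

Lemma new_gens0S d : new_gens 0 d.+1 = 'C(s + (b + d) - 1, b + d) + new_gens 0 d.
Proof.
rewrite /new_gens big_nat_recl //= bin0 mul1n subSS subn0; congr (_ + _).
by apply: eq_bigr => j _; rewrite !add0n !binn subSS.
Qed.

Lemma cap_bettiS r d i :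
  cap_betti r.+1 d i = cap_betti r d i + new_gens r d * 'C(s + r, i).
Proof. by rewrite /cap_betti big_nat_recr //= addnA. Qed.

(** The last two terms of the recursion add up to the contribution of the new variable, which is
    what [cap_bettiS] adds to the closed formula. *)
Lemma cap_betti_pair r d i :
  cap_betti r.+1 d i + (if i is i'.+1 then cap_betti r d.+1 i' else 0)
  = new_gens r d.+1 * 'C(s + r, i).
Proof.
elim: r i => [|r IH] i.
  rewrite cap_bettiS /cap_betti big_geq // addn0 new_gens0S addn0 mulnDl.
  rewrite -pow_betti_pair addnAC; congr (_ + _ + _).
  by case: i => // i; rewrite big_geq // addn0 addnS.
rewrite cap_bettiS new_gensSS mulnDl addnAC; congr (_ + _).
rewrite addnS; case: i => [|i]; first by rewrite bin0 -(bin0 (s + r)) -IH.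
by rewrite (cap_bettiS _ d.+1) addnA (IH i.+1) binS mulnDr.
Qed.

Lemma cap_bettiSS r d i : cap_betti r.+1 d.+1 i =
  cap_betti r d.+1 i
  + (cap_betti r.+1 d i + if i is i'.+1 then cap_betti r d.+1 i' else 0).
Proof. by rewrite cap_bettiS cap_betti_pair. Qed.

Lemma cap_bettiE r d i : cap_betti r d i =
  'C(s + (b + d) - 1, b + d + i) * 'C(b + d + i - 1, i)
  + \sum_(1 <= j < d.+1) \sum_(0 <= l < r)
      'C(l + j - 1, j - 1) * 'C(s + (b + d) - j - 1, b + d - j) * 'C(s + l, i).
Proof.
congr (_ + _); rewrite exchange_big; apply: eq_bigr => l _ /=.
rewrite -big_distrl big_add1 /=; congr (_ * _).
apply: eq_big_nat => j /andP[_ jd]; rewrite addnS !subn1 /=.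
by rewrite addnBA // addnBA ?(leq_trans jd) ?leq_addl.
Qed.

End BettiNumbers.

(** * Closure properties of generated ideals *)

Section IdealGeneration.
Variable R : comNzRingType.
Implicit Types (S : R -> Prop).

Lemma ideal_gen_mul S c g : S g -> ideal_gen S (c * g).
Proof.
move=> Sg; exists [:: (c, g)]; rewrite big_seq1; split=> // cg.
by rewrite inE => /eqP->.
Qed.

Lemma ideal_gen_sum S (T : eqType) (r : seq T) (F : T -> R) :
  (forall i, i \in r -> ideal_gen S (F i)) -> ideal_gen S (\sum_(i <- r) F i).
Proof.
elim: r => [|i r IH] H; first by exists [::]; rewrite !big_nil.
have [s [Ss Es]] : ideal_gen S (F i) by apply: H; rewrite mem_head.
have [|t [St Et]] := IH; first by move=> j jr; apply: H; rewrite in_cons jr orbT.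
exists (s ++ t); rewrite big_cat big_cons -Es -Et; split=> // cg.
by rewrite mem_cat => /orP[/Ss|/St].
Qed.

Lemma ideal_exp_scale S m c f : ideal_exp (ideal_gen S) m f ->
  ideal_exp (ideal_gen S) m (c * f).
Proof.
case: m => // m [s [Ss ->]]; exists [seq (c * cg.1, cg.2) | cg <- s].
rewrite big_map mulr_sumr; split=> [cg /mapP[cg' /Ss H ->] //|].
by apply: eq_bigr => cg _; rewrite mulrA.
Qed.

End IdealGeneration.

(** * Monomial ideals *)

Section MonomialIdeals.
Variables (k : fieldType) (n : nat).
Implicit Types (P Q : pred 'X_{1..n}) (J K S : {set 'I_n}) (f g : {mpoly k[n]}).

(** The span of the monomials with exponent in [P]; it is an ideal when [P] is stable under adding
    exponents. *)
Definition mon_ideal P f : Prop := forall m, m \in msupp f -> P m.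

Lemma mon_idealD P f g : mon_ideal P f -> mon_ideal P g -> mon_ideal P (f + g).
Proof. by move=> hf hg m /msuppD_le; rewrite mem_cat => /orP[/hf|/hg]. Qed.

Lemma mon_ideal_sum P (T : eqType) (r : seq T) (B : pred T) (F : T -> {mpoly k[n]}) :
  (forall i, i \in r -> B i -> mon_ideal P (F i)) ->
  mon_ideal P (\sum_(i <- r | B i) F i).
Proof.
move=> H; rewrite big_seq_cond; elim/big_ind: _; first by move=> m; rewrite msupp0.
  exact: mon_idealD.
by move=> i /andP[]; apply: H.
Qed.

Lemma mon_idealZX P c m : P m -> mon_ideal P (c *: 'X_[m] : {mpoly k[n]}).
Proof. by move=> Pm m' /msuppZ_le; rewrite msuppX inE => /eqP->. Qed.

Lemma mon_ideal_mulX P i f :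
  mon_ideal P ('X_i * f) <-> mon_ideal (fun m => P (m + U_(i))%MM) f.
Proof.
rewrite mulrC; split=> H m mf; last first.
  move: mf; rewrite (perm_mem (msuppMX _ _)) => /mapP[m' /H Pm' ->].
  by rewrite addmC.
by apply: H; rewrite (perm_mem (msuppMX _ _)) addmC; apply: map_f.
Qed.

(** The conditions on exponents say that [A] does not see the variable [i], that [P] restricts to
    [A] on monomials free of it, and that dividing by it turns [P] into [B]. *)
Lemma linear_res_mon_split i P A B d alpha beta :
    linear_res (@mon_ideal A) d.+1 alpha -> linear_res (@mon_ideal B) d beta ->
    (forall m, A m -> B m) -> (forall m, A (m + U_(i))%MM = A m) ->
    (forall m : 'X_{1..n}, m i = 0%N -> P m = A m) ->
    (forall m, P (m + U_(i))%MM = B m) ->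
  linear_res (@mon_ideal P) d.+1
    (fun l => alpha l + (beta l + if l is l'.+1 then alpha l' else 0))%N.
Proof.
move=> lA lB AB Ai P0 Pi; apply: (@linear_res_split _ _ 'X_i) lA lB _ _ _.
- exact: homog_degXi.
- apply/negP => /eqP/(congr1 (mcoeff U_(i))); rewrite mcoeffX eqxx mcoeff0.
  by move/eqP; rewrite oner_eq0.
- by move=> f Af m /Af/AB.
- by move=> f /mon_ideal_mulX H m /H; rewrite Ai.
have subK (m : 'X_{1..n}) : m i != 0%N -> (m - U_(i) + U_(i))%MM = m.
  by move=> mi; rewrite submK // lep1mP.
have AP m : A m -> P m.
  have [mi|mi] := eqVneq (m i) 0%N; first by rewrite P0.
  by rewrite -(subK m mi) Pi Ai; apply: AB.
move=> f; split=> [Pf|[g [h [Ag Bh ->]]]]; last first.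
  apply: mon_idealD => [m /Ag/AP//|].
  by apply/mon_ideal_mulX => m /Bh; rewrite Pi.
(* Separate the monomials of [f] according to divisibility by ['X_i]. *)
exists (\sum_(m <- msupp f | m i == 0%N) f@_m *: 'X_[m]).
exists (\sum_(m <- msupp f | m i != 0%N) f@_m *: 'X_[m - U_(i)]); split.
- apply: mon_ideal_sum => m mf /eqP mi; apply: mon_idealZX.
  by rewrite -P0 //; apply: Pf.
- apply: mon_ideal_sum => m mf mi; apply: mon_idealZX.
  by rewrite -Pi subK //; apply: Pf.
rewrite [LHS]mpolyE (bigID (fun m : 'X_{1..n} => m i == 0%N)) /= mulr_sumr.
congr (_ + _); apply: eq_bigr => m mi.
by rewrite -scalerAr -mpolyXD addmC subK.
Qed.

Definition deg_in S (m : 'X_{1..n}) : nat := \sum_(i in S) m i.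

Lemma deg_inD S m m' : deg_in S (m + m')%MM = (deg_in S m + deg_in S m')%N.
Proof. by rewrite -big_split; apply: eq_bigr => i _; rewrite mnmDE. Qed.

Lemma deg_inU S i : deg_in S U_(i)%MM = (i \in S).
Proof.
rewrite /deg_in; under eq_bigr => j _ do rewrite mnm1E.
case: (boolP (i \in S)) => iS.
  rewrite (bigD1 i) //= eqxx big1 ?addn0 // => j /andP[_ ji].
  by rewrite eq_sym (negPf ji).
by apply: big1 => j jS; case: eqP => // ij; rewrite ij jS in iS.
Qed.

Lemma deg_in_setD1 S i m : i \in S -> deg_in S m = (m i + deg_in (S :\ i) m)%N.
Proof. by move=> iS; rewrite /deg_in (big_setD1 i). Qed.

Lemma deg_inS S S' m : S \subset S' -> (deg_in S m <= deg_in S' m)%N.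
Proof.
move=> SS; rewrite /deg_in [leqRHS](big_setID S) /= (setIidPr SS).
exact: leq_addr.
Qed.

Lemma mon_idealM P Q (B : pred _) f g :
    (forall m m', P m -> Q m' -> B (m + m')%MM) ->
  mon_ideal P f -> mon_ideal Q g -> mon_ideal B (f * g).
Proof.
move=> H Pf Qg m /msuppM_le/allpairsP[[m1 m2] /= [m1f m2g ->]].
by apply: H; [apply: Pf | apply: Qg].
Qed.

Lemma ideal_gen_mon P (G : {mpoly k[n]} -> Prop) f :
    (forall m m', P m' -> P (m + m')%MM) ->
  (forall g, G g -> mon_ideal P g) -> ideal_gen G f -> mon_ideal P f.
Proof.
move=> up GP [s [Gs ->]]; apply: mon_ideal_sum => cg /Gs/GP Pg _.
by apply: (@mon_idealM predT P) => // m m' _; apply: up.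
Qed.

Lemma ideal_exp_mJ_X S a m : (a <= deg_in S m)%N ->
  ideal_exp (@mJ k n S) a 'X_[m].
Proof.
elim: a m => // a IH m am.
have [i iS mi] : exists2 i, i \in S & m i != 0%N.
  apply/exists_inP; apply: contraTT am => /exists_inPn H.
  by rewrite -leqNgt /deg_in big1 // => i /H/negPn/eqP.
have mE : (m - U_(i) + U_(i))%MM = m by rewrite submK // lep1mP.
have -> : 'X_[m] = 1 * ('X_i * 'X_[m - U_(i)]) :> {mpoly k[n]}.
  by rewrite mul1r -mpolyXD addmC mE.
apply: ideal_gen_mul; exists 'X_i, 'X_[m - U_(i)]; split=> //.
  by rewrite -['X_i]mul1r; apply: ideal_gen_mul; exists i.
by apply: IH; move: am; rewrite -{1}mE deg_inD deg_inU iS addn1.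
Qed.

(** Turns membership in a power into a condition on exponents, so that the intersection becomes a
    conjunction. *)
Lemma ideal_exp_mJ S a f :
  ideal_exp (@mJ k n S) a f <-> mon_ideal (fun m => (a <= deg_in S m)%N) f.
Proof.
split=> [|H].
  elim: a f => [|a IH] f; first by move=> _ m.
  apply: ideal_gen_mon => [m m' am'|_ [u [v [Su Sv ->]]]].
    by rewrite deg_inD (leq_trans am') ?leq_addl.
  apply: (@mon_idealM (fun m => 1 <= deg_in S m)%N) _ (IH _ Sv).
    by move=> m m' h h'; rewrite deg_inD -add1n leq_add.
  apply: ideal_gen_mon Su => [m m' h|_ [j jS ->]].
    by rewrite deg_inD (leq_trans h) ?leq_addl.
  by move=> m; rewrite msuppX inE => /eqP->; rewrite deg_inU jS.
case: a H => // a H; rewrite [f]mpolyE; apply: ideal_gen_sum => m /H am.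
rewrite -mul_mpolyC; apply: (@ideal_exp_scale _ _ a.+1).
exact: (@ideal_exp_mJ_X S a.+1).
Qed.

(** With [set0] and 0 for [K] and [b] this is a plain power, so one splitting lemma serves both
    inductions. *)
Definition cap_pred J K a b : pred 'X_{1..n} :=
  fun m => (a <= deg_in J m)%N && (b <= deg_in K m)%N.

(** Since [i] lies outside [K], dividing by ['X_i] lowers the degree in [J] and leaves the degree in
    [K] unchanged. *)
Lemma linear_res_cap_split J K a b i alpha beta : i \in J -> i \notin K ->
    linear_res (mon_ideal (cap_pred (J :\ i) K a.+1 b)) a.+1 alpha ->
    linear_res (mon_ideal (cap_pred J K a b)) a beta ->
  linear_res (mon_ideal (cap_pred J K a.+1 b)) a.+1
    (fun l => alpha l + (beta l + if l is l'.+1 then alpha l' else 0))%N.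
Proof.
move=> iJ iK lA lB; rewrite /cap_pred in lA lB *.
apply: (linear_res_mon_split (i := i) lA lB) => m /=.
- move=> /andP[ha ->]; rewrite andbT (leq_trans (leqnSn a)) //.
  by apply: leq_trans ha (deg_inS _ (subsetDl _ _)).
- by rewrite !deg_inD !deg_inU in_setD1 eqxx (negPf iK) !addn0.
- by move=> mi; rewrite (deg_in_setD1 m iJ) mi.
- by rewrite !deg_inD !deg_inU iJ (negPf iK) addn0 addn1.
Qed.

(** Induction on [a], then on the size of [K]; the bases are the unit ideal and, for positive
    exponent and empty [K], the zero ideal. *)
Lemma linear_res_pow K a :
  linear_res (mon_ideal (cap_pred K set0 a 0)) a (pow_betti #|K| a).
Proof.
elim: a K => [|a IHa] K.
  apply: (linear_res_eq _ _ (linear_res1 (I := fun=> True) _)) => //.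
  case=> [|i]; first by rewrite /pow_betti !bin0.
  by rewrite /pow_betti (@bin_small (0 + i.+1 - 1)) ?muln0 // subn1.
have [s] := ubnP #|K|; elim: s K => // s IHs K; rewrite ltnS => Ks.
have [->|[i iK]] := set_0Vmem K.
  apply: (linear_res_eq _ _ (linear_res0 _ (I := fun f => f = 0) _)) => // [f|i].
    split=> [->|H]; first by move=> m; rewrite msupp0.
    apply: msuppnil0; case E: (msupp f) => [//|m r].
    have := H m; rewrite E mem_head => /(_ isT).
    by rewrite /cap_pred /deg_in big_set0.
  by rewrite /pow_betti cards0 bin_small // add0n addSn subn1 ltnS leq_addr.
have cK := cardsD1 i K; rewrite iK add1n in cK.
apply: linear_res_eq (linear_res_cap_split iK _ (IHs (K :\ i) _) (IHa K)) => //.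
- by move=> l; rewrite cK pow_bettiSS -cK.
- by rewrite inE.
by rewrite cK in Ks.
Qed.

(** Induction on [d], then on the size of [J :\: K]. If [d = 0] or [J = K], one of the two degree
    conditions implies the other and a power of the ideal of [K] remains. *)
Lemma linear_res_cap J K b d : K \subset J ->
  linear_res (mon_ideal (cap_pred J K (b + d) b)) (b + d)
    (cap_betti #|K| b #|J :\: K| d).
Proof.
elim: d J => [|d IHd] J KJ.
  apply: linear_res_eq (linear_res_pow K (b + 0)) => [f|i]; last first.
    rewrite /cap_betti big1 ?addn0 // => l _.
    by rewrite /new_gens big_geq.
  have E m : cap_pred J K (b + 0) b m = cap_pred K set0 (b + 0) 0 m.
    rewrite /cap_pred addn0 andbT andb_idl // => /leq_trans; apply.
    exact: deg_inS.
  by split=> H m /H; rewrite E.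
have [r] := ubnP #|J :\: K|; elim: r J KJ => // r IHr J KJ; rewrite ltnS => Jr.
have [E|[i]] := set_0Vmem (J :\: K).
  apply: linear_res_eq (linear_res_pow K (b + d.+1)) => [f|i]; last first.
    by rewrite /cap_betti E cards0 big_geq // addn0.
  have -> : J = K.
    by apply/eqP; rewrite eqEsubset KJ andbT -setD_eq0 E.
  have E' m : cap_pred K K (b + d.+1) b m = cap_pred K set0 (b + d.+1) 0 m.
    rewrite /cap_pred andbT andb_idr // => /(leq_trans _)->//.
    exact: leq_addr.
  by split=> H m /H; rewrite E'.
rewrite inE => /andP[iK iJ].
have cJ : #|J :\: K| = #|(J :\ i) :\: K|.+1.
  rewrite (cardsD1 i) inE iK iJ add1n; congr _.+1.
  by apply: eq_card => j; rewrite !inE andbCA.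
rewrite addnS; apply: linear_res_eq (linear_res_cap_split iJ iK _ (IHd J KJ)) => //.
  by move=> l; rewrite cJ cap_bettiSS -cJ.
rewrite -addnS; apply: IHr; last by rewrite cJ in Jr.
by rewrite subsetD1 KJ.
Qed.

End MonomialIdeals.

Theorem corollary5p7 (k : fieldType) (n : nat) (a b : nat) (J K : {set 'I_n})
    (hba : (b <= a)%N) (hb : (1 <= b)%N)
    (hJ : J != set0) (hK : K != set0) (hKJ : K \subset J) :
  let I := ideal_cap (ideal_exp (@mJ k n J) a) (ideal_exp (@mJ k n K) b) in
  (forall i : nat,
     graded_betti I i (Posz (i + a)%N)
       ('C(#|K| + a - 1, a + i) * 'C(a + i - 1, i)
        + \sum_(1 <= j < (a - b).+1) \sum_(0 <= l < #|J :\: K|)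
            'C(l + j - 1, j - 1) * 'C(#|K| + a - j - 1, a - j)
            * 'C(#|K| + l, i))%N)
  /\ (forall i j : nat, j <> (i + a)%N -> graded_betti I i (Posz j) 0%N).
Proof.
have lI : linear_res (ideal_cap (ideal_exp (@mJ k n J) a) (ideal_exp (@mJ k n K) b))
    a (cap_betti #|K| b #|J :\: K| (a - b)).
  have := linear_res_cap k b (a - b) hKJ; rewrite subnKC //.
  apply: linear_res_eq => // f; rewrite /ideal_cap !ideal_exp_mJ.
  split=> [H|[HJ HK] m mf]; first by split=> m /H/andP[].
  by rewrite /cap_pred HJ ?HK.
split=> [i|i j ji].
  have := linear_res_graded_betti i (i + a) lI.
  by rewrite eqxx cap_bettiE subnKC.
by have := linear_res_graded_betti i j lI; case: eqP.
Qed.
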